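(* Let $\mathcal{P}$ be a set of $n$ points in $\mathbb{R}^2$, no three collinear. Then for every integer $i\ge 1$, \[ \hat{v}_i(\mathcal{P}) < \frac{n}{\sqrt{\pi i}}. \]
   Context: A plane graph of a finite point set $\mathcal{P}\subset\mathbb{R}^2$ has vertex set $\mathcal{P}$ (with vertices at these fixed positions) and edge set a set of straight line segments between points of $\mathcal{P}$, no two of which cross (they may share endpoints). Plane graphs are distinguished by their edge sets, so the vertices are labeled. Let $\mathcal{G}(\mathcal{P})$ be the set of all plane graphs of $\mathcal{P}$. For $G\in\mathcal{G}(\mathcal{P})$, $v_i(G)$ is the number of vertices of degree $i$ in $G$. $\hat{v}_i(\mathcal{P})=\frac{1}{|\mathcal{G}(\mathcal{P})|}\sum_{G\in\mathcal{G}(\mathcal{P})} v_i(G)$ is the expected number of degree-$i$ vertices in a plane graph of $\mathcal{P}$ chosen uniformly at random. *)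

(* Defs.v *)
From mathcomp Require Import all_boot all_order all_algebra.
From mathcomp Require Import finmap.
From mathcomp Require Import boolp classical_sets reals trigo.

Set Implicit Arguments.
Unset Strict Implicit.
Unset Printing Implicit Defensive.

Import Order.TTheory GRing.Theory Num.Theory.
Local Open Scope ring_scope.

Definition segment (R : realType) (a b : 'rV[R]_2) : set 'rV[R]_2 :=
  [set x | exists2 t : R, 0 <= t <= 1 & x = (1 - t) *: a + t *: b]%classic.

Definition collinear (R : realType) (A : set 'rV[R]_2) : Prop :=
  exists q d : 'rV[R]_2,
    d != 0 /\ (A `<=` [set q + t *: d | t in setT])%classic.

Definition no_three_collinear (R : realType) (P : {fset 'rV[R]_2}) : Prop :=
  forall a b c, a \in P -> b \in P -> c \in P ->
    a != b -> a != c -> b != c -> ~ collinear [set a; b; c]%classic.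

(* A segment between two points of P is encoded by the set of its two
   endpoints, so a labeled graph on P is a {set {set P}}. *)
Definition edge_segment (R : realType) (P : {fset 'rV[R]_2}) (e : {set P}) :
    set 'rV[R]_2 :=
  [set x | exists a b : P, e = [set a; b]%SET /\ segment (val a) (val b) x]%classic.

(* Edges e and f cross when their segments meet at a point other than a
   common endpoint. *)
Definition cross (R : realType) (P : {fset 'rV[R]_2}) (e f : {set P}) : Prop :=
  exists x, [/\ edge_segment e x, edge_segment f x &
                forall v : P, v \in e -> v \in f -> x != val v].

Definition plane_graph (R : realType) (P : {fset 'rV[R]_2})
    (G : {set {set P}}) : Prop :=
  (forall e, e \in G -> #|e| = 2%N) /\
  (forall e f, e \in G -> f \in G -> e != f -> ~ cross e f).

Definition plane_graphs (R : realType) (P : {fset 'rV[R]_2}) :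
    {set {set {set P}}} :=
  [set G : {set {set P}} | `[< plane_graph G >]]%SET.

Definition degree (T : finType) (G : {set {set T}}) (v : T) : nat :=
  #|[set e in G | v \in e]%SET|.

Definition num_degree (T : finType) (i : nat) (G : {set {set T}}) : nat :=
  #|[set v : T | degree G v == i]%SET|.

Definition vhat (R : realType) (i : nat) (P : {fset 'rV[R]_2}) : R :=
  (\sum_(G in plane_graphs P) (num_degree i G)%:R) / #|plane_graphs P|%:R.

(* Main.v *)
(* Fix a vertex [v] and group the plane graphs by what remains once the edges
   at [v] are deleted. No two edges at [v] cross, so if [k] edges at [v] can be
   inserted individually into the remaining graph [H], then the class of [H]
   consists of the [2 ^ k] graphs obtained by inserting any subset of them,
   and a fraction ['C(k, i) / 2 ^ k <= 'C(2i, i) / 4 ^ i] of these give [v]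
   degree [i]. The strict bound ['C(2i, i) / 4 ^ i < 1 / sqrt (pi i)] is
   Wallis': the integral of [cos ^ (2i)] over [0, pi / 2] is smaller than that
   of [cos ^ (2i - 1)]. *)
Require Import Defs.
From mathcomp Require Import all_boot all_order all_algebra.
From mathcomp Require Import finmap.
From mathcomp Require Import boolp classical_sets reals trigo.
From mathcomp Require Import functions topology normedtype derive.
From mathcomp Require Import ring lra zify.
From mathcomp Require Import fintype finset.

Import Order.TTheory GRing.Theory Num.Theory.
Import numFieldNormedType.Exports.
Local Open Scope ring_scope.

(** * Binomial estimates and counting *)

Lemma mul_bin_central n :
  (n.+1 * 'C(n.+1.*2, n.+1) = (n.*2.+1).*2 * 'C(n.*2, n))%N.
Proof.
rewrite -mul_bin_diag /= doubleS.
have := mul_bin_down n.*2.+1 n; rewrite /= => h.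
have e : (n.*2.+1 - n = n.+1)%N by lia.
by rewrite e in h; nia.
Qed.

(** Passing from [k] to [k.+1] multiplies ['C(k, i) / 2 ^ k] by [(k + 1) / (2 (k + 1 - i))], which
    is at least 1 exactly when [k + 1 <= 2i]. Hence the maximum is at [k = 2i], and the induction is
    on the distance to it from either side. *)
Lemma bin_le_central k i : ('C(k, i) * 4 ^ i <= 'C(i.*2, i) * 2 ^ k)%N.
Proof.
have e4 : (4 ^ i = 2 ^ i.*2)%N by rewrite -mul2n expnM.
have [ki|/ltnW/subnKC <-] := leqP k i.*2.
  have [d] : exists d, (k + d = i.*2)%N by exists (i.*2 - k)%N; lia.
  elim: d k {ki} => [|d IH] k kd; first by rewrite -kd addn0 in e4 *; rewrite e4.
  have h : (2 * 'C(k, i) <= 'C(k.+1, i))%N.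
    rewrite -(leq_pmul2l (ltn0Sn k)) mulnCA (mul_bin_down k.+1 i) mulnA.
    by rewrite leq_mul2r; lia.
  rewrite -(leq_pmul2l (ltn0Sn 1)) mulnA mulnCA -expnS.
  by apply: leq_trans (IH k.+1 ltac:(lia)); rewrite leq_mul2r h orbT.
elim: (k - i.*2)%N => [|j IH]; first by rewrite addn0 e4.
have h : ('C((i.*2 + j).+1, i) <= 2 * 'C(i.*2 + j, i))%N.
  rewrite -(leq_pmul2l (ltn0Sn (i + j))) mulnCA.
  have e : ((i.*2 + j).+1 - i = (i + j).+1)%N by lia.
  by rewrite -{1}e -(mul_bin_down (i.*2 + j).+1 i) mulnA leq_mul2r; lia.
rewrite addnS expnS mulnCA; apply: leq_trans (leq_mul (leqnn 2) IH).
by rewrite mulnA leq_mul2r h orbT.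
Qed.

(** The inequality is proved on each fiber of the map deleting [A]: a nonempty fiber over [H]
    consists of the unions of [H] with arbitrary subsets of [S H]. *)
Lemma card_star_le (E : finType) (F : {set {set E}}) (A : {set E})
    (S : {set E} -> {set E}) (i : nat) :
  (forall H, S H \subset A) ->
  (forall G, (G \in F) = (G :\: A \in F) && (G :&: A \subset S (G :\: A))) ->
  (#|[set G in F | #|G :&: A| == i]| * 4 ^ i <= 'C(i.*2, i) * #|F|)%N.
Proof.
move=> SA FS.
have fibers (X : {set {set E}}) :
    #|X| = (\sum_H #|[set G in X | G :\: A == H]|)%N.
  rewrite -sum1_card (partition_big (fun G => G :\: A) predT) //=.
  by apply: eq_bigr => H _; rewrite sum1dep_card.
rewrite (fibers F) (fibers [set _ | _]) big_distrl big_distrr /=.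
apply: leq_sum => H _.
(* Any other [H] has an empty fiber, so the left side is 0. *)
have [HF|HF] := boolP ((H \in F) && (H :&: A == set0)); last first.
  suff -> : #|[set G in [set G in F | #|G :&: A| == i] | G :\: A == H]| = 0%N by [].
  apply: eq_card0 => G. rewrite !inE.
  apply/negbTE; apply: contra HF => /andP[/andP[GF _] /eqP<-].
  by move: GF; rewrite FS => /andP[-> _]; rewrite setIDAC setDE -setIA setICr setI0 eqxx.
case/andP: HF => HF /eqP HA.
have HD : H :\: A = H by apply/setDidPl; rewrite -setI_eq0 HA.
have HT (T : {set E}) : T \subset S H -> (H :|: T) :\: A = H /\ (H :|: T) :&: A = T.
  move=> TS; have TA := subset_trans TS (SA H).
  rewrite setDUl HD setIUl HA set0U (setIidPl TA).
  by have /eqP -> : T :\: A == set0; rewrite ?setD_eq0 ?setU0.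
set X := [set _ | _]; set Y := [set _ | _].
have Xle : (#|X| <= 'C(#|S H|, i))%N.
  rewrite -cards_draws.
  have <- : #|[set G :&: A | G in X]| = #|X|.
    apply: card_in_imset => G1 G2; rewrite !inE => /andP[_ /eqP e1] /andP[_ /eqP e2] e.
    by rewrite -(setID G1 A) -(setID G2 A) e e1 e2.
  apply/subset_leq_card/subsetP => _ /imsetP[G + ->]; rewrite !inE.
  move=> /andP[/andP[GF Gi] /eqP e]; rewrite Gi andbT.
  by move: GF; rewrite FS e => /andP[].
have Yge : (2 ^ #|S H| <= #|Y|)%N.
  rewrite -card_powerset.
  have <- : #|[set H :|: T | T in powerset (S H)]| = #|powerset (S H)|.
    apply: card_in_imset => T1 T2; rewrite !inE => /HT[_ e1] /HT[_ e2] e.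
    by rewrite -e1 -e2 e.
  apply/subset_leq_card/subsetP => _ /imsetP[T + ->]; rewrite !inE => TS.
  by have [e1 e2] := HT T TS; rewrite FS e1 e2 HF TS eqxx.
apply: leq_trans (leq_mul Xle (leqnn _)) _.
by apply: leq_trans (bin_le_central _ _) _; rewrite leq_mul2l Yge orbT.
Qed.

(** * Edges sharing a vertex *)

Section PlaneGraphs.
Variables (R : realType) (P : {fset 'rV[R]_2}).
Implicit Types (e f : {set P}) (v a : P) (G : {set {set P}}).

Lemma cross_sym e f : cross e f -> cross f e.
Proof. by case=> x [xe xf xv]; exists x; split=> // v vf ve; apply: xv. Qed.

Lemma edge_at v e : v \in e -> #|e| = 2%N -> exists2 a, v != a & e = [set v; a]%SET.
Proof.
move=> + /eqP/cards2P[a [b [ab e_ab]]]; rewrite {}e_ab !inE => /pred2P[]->.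
  by exists b.
by exists a; rewrite 1?eq_sym// setUC.
Qed.

Lemma edge_segment_line v a x : edge_segment [set v; a]%SET x ->
  exists t : R, x = val v + t *: (val a - val v).
Proof.
have lineE (p q : 'rV[R]_2) (t : R) : (1 - t) *: p + t *: q = p + t *: (q - p).
  by rewrite scalerBl scalerBr scale1r addrAC addrA.
case=> b [c [/setP e_bc [t _ ->]]]; rewrite lineE.
(* An unordered pair fixes no order of [b] and [c]. Membership alone leaves four cases; the
   degenerate ones [b = c] also lie on the line. *)
have /setU1P[->|/set1P->] : b \in [set v; a]%SET by rewrite e_bc set21.
  have /setU1P[->|/set1P->] : c \in [set v; a]%SET by rewrite e_bc set22.
    by exists 0; rewrite subrr scale0r scaler0.
  by exists t.
have /setU1P[->|/set1P->] : c \in [set v; a]%SET by rewrite e_bc set22.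
  by exists (1 - t); rewrite -!lineE subKr addrC.
by exists 1; rewrite subrr scaler0 addr0 scale1r addrC subrK.
Qed.

Hypothesis genP : no_three_collinear P.

(** A crossing point differs from [v], so the lines carrying the two edges share two points and
    coincide, which puts three points of [P] on a line. *)
Lemma star_noncrossing v e f : v \in e -> v \in f ->
  #|e| = 2%N -> #|f| = 2%N -> e != f -> ~ cross e f.
Proof.
move=> ve vf e2 f2 ef [x [+ + /(_ v ve vf)]].
have [a va e_va] := edge_at v e ve e2; have [b vb f_vb] := edge_at v f vf f2.
have ab : a != b by apply: contraNneq ef => ab; rewrite e_va f_vb ab.
rewrite e_va f_vb => /edge_segment_line[t ->] /edge_segment_line[s ts].
rewrite ts -subr_eq0 addrC addKr => sx.
have s0 : s != 0 by apply: contraNneq sx => ->; rewrite scale0r.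
apply: (genP (val v) (val a) (val b)) => //; try exact: valP.
exists (val v), (val a - val v); split.
  by rewrite subr_eq0 eq_sym.
move=> _ [[->|->]|->] /=.
- by exists 0 => //; rewrite scale0r addr0.
- by exists 1 => //; rewrite scale1r addrC subrK.
exists (s^-1 * t) => //; move/addrI: ts; rewrite -scalerA => ->.
by rewrite scalerA mulVf// scale1r addrC subrK.
Qed.

Definition star v : {set {set P}} := [set e : {set P} | v \in e]%SET.

Definition insertable v (H : {set {set P}}) : {set {set P}} :=
  [set e in star v | (#|e| == 2%N) && `[< forall f, f \in H -> ~ cross e f >]]%SET.

(** This is the product structure that [card_star_le] asks for. Edges at [v] are tested only against
    the rest of the graph, since by [star_noncrossing] they never obstruct each other. *)
Lemma plane_graph_star v G :
  (G \in plane_graphs P) = (G :\: star v \in plane_graphs P)%SET &&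
    (G :&: star v \subset insertable v (G :\: star v))%SET.
Proof.
apply/idP/andP; rewrite !inE.
  move=> /asboolP[G2 Gx]; split.
    apply/asboolP; split=> [e|e f] /setDP[eG _]; first exact: G2.
    by case/setDP=> fG _; exact: Gx.
  apply/subsetP => e /setIP[eG ev]; rewrite inE ev G2//=.
  apply/asboolP => f /setDP[fG fv]; apply: Gx => //.
  by apply: contraNneq fv => <-.
move=> [/asboolP[G2 Gx] /subsetP GS]; apply/asboolP.
have GP e : e \in G -> v \in e ->
    #|e| = 2%N /\ forall f, f \in G -> v \notin f -> ~ cross e f.
  move=> eG ve; have := GS e; rewrite !inE eG ve => /(_ isT)/and3P[_ /eqP e2 /asboolP ef].
  by split=> // f fG vf; apply: ef; rewrite !inE fG vf.
split=> [e eG|e f eG fG ef].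
  have [/(GP e eG)[]//|ve] := boolP (v \in e).
  by apply: G2; rewrite !inE eG ve.
have [ve|ve] := boolP (v \in e); have [vf|vf] := boolP (v \in f).
- by apply: (star_noncrossing v) => //; [case: (GP e)|case: (GP f)].
- by have [_ /(_ f fG vf)] := GP e eG ve.
- by move/cross_sym; have [_ /(_ e eG ve)] := GP f fG vf.
- by apply: Gx => //; rewrite !inE ?eG ?fG ?ve ?vf.
Qed.

End PlaneGraphs.

(** * Wallis' bound on central binomial coefficients *)

Section Wallis.
Variable R : realType.

(* The integral of [cos ^+ n] over [0, pi / 2] is [w]; going through an
   antiderivative avoids Lebesgue integration. *)
Definition cos_integral (n : nat) (w : R) : Prop :=
  exists2 F : R -> R, forall x, is_derive x (1 : R) F (cos x ^+ n) & F (pi / 2) - F 0 = w.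

Lemma cos_integral0 : cos_integral 0 (pi / 2).
Proof.
by exists id => [x|]; rewrite ?subr0// expr0; exact: is_derive_id.
Qed.

Lemma cos_integral1 : cos_integral 1 1.
Proof.
exists sin => [x|]; last by rewrite sin_pihalf sin0 subr0.
by rewrite expr1; exact: is_derive_sin.
Qed.

(** Integration by parts; the boundary term [cos ^+ n.+1 * sin] vanishes at both 0 and [pi / 2]. *)
Lemma cos_integralSS n w :
  cos_integral n w -> cos_integral n.+2 (n.+1%:R / n.+2%:R * w).
Proof.
move=> [F F' <-].
exists (n.+2%:R^-1 \*: ((cos : R -> R) ^+ n.+1 * sin + n.+1%:R \*: F)) => [x|].
  apply: is_derive_eq.
  rewrite /GRing.scale/= fctE.
  have n0 : n.+2%:R != 0 :> R by rewrite pnatr_eq0.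
  have s2 : sin x * sin x = 1 - cos x ^+ 2.
    by rewrite -(cos2Dsin2 x) [cos x ^+ 2 + _]addrC addrK expr2.
  have -> : sin x * (n.+1%:R * cos x ^+ n * - sin x) =
      - n.+1%:R * cos x ^+ n * (sin x * sin x) by ring.
  rewrite s2 !exprS; field.
  by rewrite -natrD.
rewrite /GRing.scale /= !fctE cos_pihalf sin0 exprS !mul0r mulr0 !add0r.
rewrite -[(_ \*: F) _]/(_ * F _) -[(_ \*: F) 0]/(_ * F 0).
by rewrite -scalerBr -mulrBr -[LHS]/(n.+2%:R^-1 * _) mulrA [_^-1 * _]mulrC.
Qed.

(** By the mean value theorem, the difference is [pi / 2] times [cos c ^+ n * (1 - cos c)] for some
    [c] strictly between 0 and [pi / 2]. *)
Lemma cos_integral_ltS n w w' :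
  cos_integral n w -> cos_integral n.+1 w' -> w' < w.
Proof.
move=> [F F' <-] [G G' <-].
have pi2 : 0 < pi / 2 :> R by rewrite divr_gt0 ?pi_gt0.
have [|c /[!in_itv]/= /andP[c0 c1] e] :=
    MVT (f := F - G) pi2 (fun x _ => is_deriveB (F' x) (G' x)).
  by apply: derivable_within_continuous => x _; apply: derivableB.
have cc : 0 < cos c by rewrite cos_gt0_pihalf// c1 (lt_trans _ c0)// oppr_lt0.
have ss : 0 < sin c by rewrite sin_gt0_pihalf// c0.
have : 0 < cos c ^+ n - cos c ^+ n.+1.
  rewrite exprS -{1}[cos c ^+ n]mul1r -mulrBl mulr_gt0 ?exprn_gt0// subr_gt0.
  have := cos2Dsin2 c; nra.
move/mulr_gt0/(_ pi2); rewrite subr0 in e; rewrite -{}e /=.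
rewrite -[(F - G) _]/(F _ - G _) -[(F - G) 0]/(F 0 - G 0); lra.
Qed.

(** The probability of exactly [n] heads in [2n] fair coin tosses. *)
Definition central n : R := 'C(n.*2, n)%:R / 4 ^+ n.

Lemma central_gt0 n : 0 < central n.
Proof. by rewrite divr_gt0 ?exprn_gt0// ltr0n bin_gt0 -addnn leq_addr. Qed.

Lemma centralS n : central n.+1 = n.*2.+1%:R / n.*2.+2%:R * central n.
Proof.
have := congr1 (fun m => m%:R : R) (mul_bin_central n); rewrite /central !natrM => h.
have -> : n.*2.+2%:R = 2 * n.+1%:R :> R by rewrite -natrM mul2n doubleS.
have n0 : n.+1%:R != 0 :> R by rewrite pnatr_eq0.
have -> : 'C(n.+1.*2, n.+1)%:R = (n.*2.+1).*2%:R * 'C(n.*2, n)%:R / n.+1%:R :> R.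
  by rewrite -h mulrAC mulfV// mul1r.
rewrite exprS -[(n.*2.+1).*2]mul2n natrM; field.
by rewrite nat1r n0 expf_neq0 ?pnatr_eq0.
Qed.

Lemma cos_integral_even n : cos_integral n.*2 (pi / 2 * central n).
Proof.
elim: n => [|n IH]; first by rewrite /central bin0 divr1 mulr1; exact: cos_integral0.
by rewrite centralS mulrCA doubleS; exact: cos_integralSS.
Qed.

Lemma cos_integral_odd n : cos_integral n.*2.+1 (n.*2.+1%:R * central n)^-1.
Proof.
elim: n => [|n IH].
  by rewrite /central bin0 divr1 mulr1 invr1; exact: cos_integral1.
rewrite centralS doubleS.
have := cos_integralSS _ _ IH; congr cos_integral.
move: (central n) n.*2.+1%:R n.*2.+2%:R n.*2.+3%:R => c x y z.
by rewrite !invfM invrK; ring.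
Qed.

Lemma central_lt n : (0 < n)%N -> central n < (Num.sqrt (pi * n%:R))^-1.
Proof.
case: n => // n _.
have c0 := central_gt0 n.+1.
have n0 : 0 < n.+1%:R :> R by rewrite ltr0n.
have p0 := @pi_gt0 R.
(* With [m = n + 1] and [c = central m], comparing exponents [2m - 1] and [2m] gives
   [pi / 2 * c < 1 / (2 m c)], that is [pi * m * c ^ 2 < 1]. *)
have := cos_integral_ltS _ _ _ (cos_integral_odd n) (cos_integral_even n.+1).
have -> : n.*2.+1%:R * central n = 2 * n.+1%:R * central n.+1.
  rewrite centralS -natrM mul2n doubleS.
  by move: (central n) => c; rewrite mulrA [_ * (_ / _)]mulrCA mulfV ?mulr1// pnatr_eq0.
move: (central n.+1) c0 => c c0.
rewrite -[X in _ < X]mul1r ltr_pdivlMr ?mulr_gt0// => h.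
rewrite -[X in X < _]ger0_norm ?ltW// -sqrtr_sqr -sqrtrV ?mulr_ge0 ?ltW//.
rewrite ltr_sqrt ?invr_gt0 ?mulr_gt0// -[X in _ < X]mul1r ltr_pdivlMr ?mulr_gt0//.
by apply: le_lt_trans h; rewrite le_eqVlt; apply/orP; left; apply/eqP; field.
Qed.
End Wallis.

(** * Averaging over the vertices *)

Lemma card_degree_le (R : realType) (P : {fset 'rV[R]_2}) (i : nat) (v : P) :
  no_three_collinear P ->
  (#|[set G in plane_graphs P | degree G v == i]%SET| * 4 ^ i
     <= 'C(i.*2, i) * #|plane_graphs P|)%N.
Proof.
move=> genP.
have -> : [set G in plane_graphs P | degree G v == i]%SET =
    [set G in plane_graphs P | #|(G :&: star _ _ v)%SET| == i]%SET.
  apply/setP => G; rewrite !inE /degree; congr (_ && (#|pred_of_set _| == i)).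
  by apply/setP => e; rewrite !inE.
apply: (card_star_le _ _ _ (insertable _ _ v)) => [H|G].
  by apply/subsetP => e; rewrite !inE => /andP[].
exact: plane_graph_star.
Qed.

Lemma sum_num_degree (T : finType) (A : {set {set {set T}}}) (i : nat) :
  (\sum_(G in A) num_degree i G = \sum_v #|[set G in A | degree G v == i]%SET|)%N.
Proof.
under eq_bigr => G _.
  rewrite /num_degree -sum1dep_card big_mkcond /=.
  over.
rewrite exchange_big /=; apply: eq_bigr => v _.
by rewrite -big_mkcondr sum1dep_card.
Qed.

Theorem theorem1p3 (R : realType) (n : nat) (P : {fset 'rV[R]_2})
    (n_gt0 : (0 < n)%N) (cardP : #|` P|%fset = n)
    (genP : no_three_collinear P) (i : nat) (i_ge1 : (1 <= i)%N) :
  vhat i P < n%:R / Num.sqrt (pi * i%:R).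
Proof.
(* The empty graph makes the denominator of [vhat] positive. *)
have empty_plane : set0 \in plane_graphs P.
  by rewrite inE; apply/asboolP; split=> [e|e f]; rewrite inE.
have PG0 : 0 < #|plane_graphs P|%:R :> R.
  by rewrite ltr0n card_gt0; apply/set0Pn; exists set0.
have cP : #|{: P}| = n by rewrite -cardP cardfE.
apply: (@le_lt_trans _ _ (n%:R * central R i)); last first.
  by rewrite ltr_pM2l ?ltr0n// central_lt.
(* Linearity of expectation: each vertex has degree [i] with probability at most [central R i]. *)
rewrite /vhat -natr_sum sum_num_degree ler_pdivrMr// natr_sum.
rewrite -mulrA -cP mulr_natl -sumr_const; apply: ler_sum => v _.
rewrite /central mulrAC ler_pdivlMr ?exprn_gt0//.
by rewrite -natrX -!natrM ler_nat card_degree_le.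
Qed.
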